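(* There is a Banach space $X$ and a sequence $(e_i)_{i\in\mathbb{N}}$ in $X$ with the following properties: (a) $(e_i)$ is a normalized 1-unconditional basis for $X$. (b) For any normalized block basis of $(e_i)$ having a spreading model $(\tilde x_i)$, the sequence $(\tilde x_i)$ is not equivalent to the unit vector basis of $\ell_1$. (c) For any normalized block basis of $(e_i)$ having a spreading model $(\tilde x_i)$, the space $\ell_1$ embeds isomorphically into the closed linear span $[(\tilde x_i)]$.
   Context: Banach spaces are real. A seminormalized sequence $(x_i)$ in a Banach space has (generates) the spreading model $(\tilde x_i)$, where $(\tilde x_i)$ is a basic sequence in some Banach space, if for some sequence $\varepsilon_n\searrow 0$ one has, for all $n\in\mathbb{N}$, all $(a_i)_{i=1}^n\in[-1,1]^n$ and all integers $n\le k_1<\dots<k_n$, $$\left|\Big\|\sum_{i=1}^n a_i x_{k_i}\Big\|-\Big\|\sum_{i=1}^n a_i\tilde x_i\Big\|\right|<\varepsilon_n .$$ *)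

(* Defs.v *)
From HB Require Import structures.
From mathcomp Require Import all_boot all_order all_algebra.
From mathcomp Require Import all_classical all_reals all_analysis.

Set Implicit Arguments.
Unset Strict Implicit.
Unset Printing Implicit Defensive.

Import Order.TTheory GRing.Theory Num.Theory.
Import numFieldNormedType.Exports.

Local Open Scope classical_set_scope.
Local Open Scope ring_scope.

Section Ell1.
Context (R : realType).

Definition abs_summable : {pred nat -> R^o} :=
  fun a => `[< cvgn (series (fun i => `|a i|)) >].

Lemma abs_summableP (a : nat -> R^o) :
  reflect (cvgn (series (fun i => `|a i|))) (a \in abs_summable).
Proof. exact: asboolP. Qed.

Lemma abs_summable_submod_closed : submod_closed abs_summable.
Proof.
split=> [|c a b /abs_summableP ca /abs_summableP cb]; apply/abs_summableP.
  rewrite (_ : series _ = cst 0); first exact: is_cvg_cst.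
  by apply/funext => n; rewrite /series /= big1 // => i _; rewrite normr0.
have h := is_cvg_seriesD (is_cvg_seriesZ (k := `|c|) ca) cb.
apply: (series_le_cvg _ _ _ h) => n //.
  by rewrite addr_ge0 ?mulr_ge0.
by rewrite (le_trans (ler_normD _ _)) // lerD2r [leLHS]normrM.
Qed.

HB.instance Definition _ :=
  GRing.isSubmodClosed.Build R (nat -> R^o) abs_summable
    abs_summable_submod_closed.

Record ell1 := Ell1 { ell1_val :> nat -> R^o ; _ : ell1_val \in abs_summable }.

HB.instance Definition _ := [isSub for ell1_val].
HB.instance Definition _ := [Choice of ell1 by <:].
HB.instance Definition _ := [SubChoice_isSubLmodule of ell1 by <:].

Definition ell1_norm (a : ell1) : R := limn (series (fun i => `|a i|)).

Lemma ell1_cvg (a : ell1) : cvgn (series (fun i => `|a i|)).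
Proof. exact/abs_summableP/(valP a). Qed.

Lemma ell1_normD a b : ell1_norm (a + b) <= ell1_norm a + ell1_norm b.
Proof.
rewrite /ell1_norm -lim_seriesD; [|exact: ell1_cvg|exact: ell1_cvg].
apply: lim_series_le; first exact: ell1_cvg.
  by apply: is_cvg_seriesD; exact: ell1_cvg.
by move=> n; exact: ler_normD.
Qed.

Lemma ell1_normZ (c : R) a : ell1_norm (c *: a) = `|c| * ell1_norm a.
Proof.
have -> : `|c| * ell1_norm a = limn (series (`|c| *: (fun i => `|a i|))).
  by rewrite lim_seriesZ //; exact: ell1_cvg.
rewrite /ell1_norm; congr (limn (series _)); apply/funext => i.
exact: normrM.
Qed.

Lemma ell1_norm0_eq0 a : ell1_norm a = 0 -> a = 0.
Proof.
move=> a0; apply/val_inj/funext => i /=; apply/eqP; rewrite -normr_le0 -a0 /ell1_norm.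
have nd : nondecreasing_seq (series (fun i => `|a i|)).
  exact: nondecreasing_series.
apply: (@le_trans _ _ (series (fun i => `|a i|) i.+1)); last first.
  exact: (nondecreasing_cvgn_le nd (@ell1_cvg a)).
by rewrite /series /= big_nat_recr //= lerDr sumr_ge0.
Qed.

HB.instance Definition _ :=
  Lmodule_isNormed.Build R ell1 ell1_normD ell1_normZ ell1_norm0_eq0.

Lemma ell1_unit_subproof (n : nat) :
  (fun i => (i == n)%:R : R^o) \in abs_summable.
Proof.
apply/abs_summableP; apply/cvg_ex; exists 1.
apply: cvg_near_cst; near=> m.
have nm : (n < m)%N by near: m; exact: nbhs_infty_gt.
rewrite /series /= (bigD1_seq n) ?mem_index_iota ?iota_uniq //= eqxx normr1.
by rewrite big1 ?addr0 // => i /negPf ->; rewrite normr0.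
Unshelve. all: by end_near. Qed.

(* the unit vector basis of ell_1 *)
Definition ell1_unit (n : nat) : ell1 := Ell1 (ell1_unit_subproof n).

End Ell1.

Section Bases.
Context (R : realType).

Definition lin_span (V : lmodType R) (x : nat -> V) : set V :=
  [set v | exists (n : nat) (a : nat -> R), v = \sum_(i < n) a i *: x i].

Definition closed_span (V : normedModType R) (x : nat -> V) : set V :=
  closure (lin_span x).

(* [S] plays the role of the closed subspace of which [x] is a basis *)
Definition schauder_basis_of (V : normedModType R) (S : set V)
    (x : nat -> V) : Prop :=
  (forall i, S (x i)) /\
  forall v, S v -> exists! a : nat -> R, series (fun i => a i *: x i) @ \oo --> v.

Definition schauder_basis (V : normedModType R) (x : nat -> V) : Prop :=
  schauder_basis_of setT x.

Definition basic_sequence (V : normedModType R) (x : nat -> V) : Prop :=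
  schauder_basis_of (closed_span x) x.

Definition normalized (V : normedModType R) (x : nat -> V) : Prop :=
  forall i, `|x i| = 1.

Definition seminormalized (V : normedModType R) (x : nat -> V) : Prop :=
  exists c C : R, 0 < c /\ forall i, c <= `|x i| <= C.

(* unconditional constant 1: the signs are given by [s] *)
Definition one_unconditional (V : normedModType R) (x : nat -> V) : Prop :=
  forall (n : nat) (a : nat -> R) (s : nat -> bool),
    `|\sum_(i < n) ((-1) ^+ s i * a i) *: x i| <= `|\sum_(i < n) a i *: x i|.

Definition block_basis (V : normedModType R) (e x : nat -> V) : Prop :=
  (forall j, x j != 0) /\
  exists (p : nat -> nat) (a : nat -> R),
    (forall j, (p j < p j.+1)%N) /\
    forall j, x j = \sum_(p j <= i < p j.+1) a i *: e i.

Definition equivalent_seq (V W : normedModType R)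
    (x : nat -> V) (y : nat -> W) : Prop :=
  exists c C : R, 0 < c /\ forall (n : nat) (a : nat -> R),
    c * `|\sum_(i < n) a i *: y i| <= `|\sum_(i < n) a i *: x i|
                                   <= C * `|\sum_(i < n) a i *: y i|.

(* Sequences are indexed from 0, so [x k] is the (k+1)-st term: for N = n+1
   vectors, the condition N <= k_1 on 1-based indices becomes n <= k ord0. *)
Definition has_spreading_model (V : normedModType R) (x : nat -> V)
    (W : completeNormedModType R) (y : nat -> W) : Prop :=
  [/\ seminormalized x, basic_sequence y &
    exists eps : nat -> R,
      [/\ nonincreasing_seq eps, eps @ \oo --> 0 &
        forall (n : nat) (a : 'I_n.+1 -> R) (k : 'I_n.+1 -> nat),
          (forall i, -1 <= a i <= 1) ->
          (n <= k ord0)%N ->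
          {homo k : i j / (i < j)%N} ->
          `| `|\sum_(i < n.+1) a i *: x (k i)|
             - `|\sum_(i < n.+1) a i *: y i| | < eps n]].

Definition embeds_in (V W : normedModType R) (S : set W) : Prop :=
  exists f : {linear V -> W},
    (forall v, S (f v)) /\
    exists c C : R, 0 < c /\ forall v, c * `|v| <= `|f v| <= C * `|v|.

End Bases.

(* Main.v *)
Require Import Defs.
From HB Require Import structures.
From mathcomp Require Import all_boot all_order all_algebra.
From mathcomp Require Import all_classical all_reals all_analysis.
From mathcomp Require Import ring lra zify.

Set Implicit Arguments.
Unset Strict Implicit.
Unset Printing Implicit Defensive.

Import Order.TTheory GRing.Theory Num.Theory.
Import numFieldNormedType.Exports.
Local Open Scope classical_set_scope.
Local Open Scope ring_scope.

(** Put theta_k = 2^-(k+2), so that the theta_k sum to 1/2, and let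
    n_k = (k+1)^(3(k+2)), which grows faster than any power of 1 / theta_k. The
    norm of the space is the solution of the implicit equation
<<
      |v|   = max (sup_j |v_j|, sup_p sum_(k < p) |v restricted to [p, oo)|_k),
      |v|_k = theta_k sup sum_(i < n_k) |E_i v|,
>>
    where the last supremum runs over successive intervals
    E_0 < E_1 < E_2 < ... It is realized as the supremum over an inductively
    generated family of functionals ([functional]), and the two inequalities
    hidden in the equation are [sum_lev_le] and [norm_le_lev].

    Let x be a normalized block basis generating the spreading model y, and
    write phi n for the norm of y_0 + ... + y_(n-1).

    - Level k alone gives phi n_k >= theta_k n_k. Since n_k is so large, the
      ratio phi n / n cannot lose a factor 3/4 each time n is multiplied by a
      fixed N. Hence for arbitrarily large N there is an m such that the average
      z of N consecutive sums of m terms of y, each normalized, has norm at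
      least 3/4 ([flat_averages]).
    - The intervals of a level k with n_k much smaller than N split few of the
      N summands of z, so |z|_k is at most about theta_k. The low levels
      together therefore contribute little more than 1/2, and a fixed part of
      the norm of z comes from levels beyond any prescribed K
      ([key_estimate]).
    - The sum of |x_j|_k over the levels available at x_j is at most 1. After
      passing to a subsequence, the tails of these sums are uniformly small, as
      long as only the levels available at earlier terms are counted
      ([tame_subsequence]). That suffices, because a functional meeting two
      terms of the sequence is restricted by the position of the first one
      ([tame_upper]).

    If y were equivalent to the basis of l_1, the coefficients of z would have
    bounded sum, so the high levels would contribute almost nothing to z,
    contradicting the second point ([not_ell1_lower]). In every case, for a
    fixed z, the contribution of the high levels is carried by a finite window
    [K, K') of levels with K as large as desired ([flat_block]). Repeating this
    along disjoint windows yields successive blocks u_0, u_1, ... of y. Far out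
    in the sequence all these levels are available at once, and their seminorms
    are added up in the norm, so the norm of the sum of the b_j u_j is at least
    1/16 of the sum of the |b_j|: the u_j span l_1
    ([spreading_embeds_ell1]). *)

(** * Norming functionals *)

Section Functionals.
Context (R : realType).

Definition weight (k : nat) : R := 2^-1 ^+ k.+2.

Definition arity (k : nat) : nat := (k.+1 ^ (3 * k.+2))%N.

Lemma weight_gt0 k : 0 < weight k.
Proof. by rewrite exprn_gt0 // invr_gt0 ltr0n. Qed.

Lemma weight_le1 k : weight k <= 1.
Proof. by rewrite exprn_ile1 // ?invr_ge0 ?ler0n // invf_le1 ?ler1n // ltr0n. Qed.

Lemma sum_weight p : \sum_(k < p) weight k <= 2^-1.
Proof.
suff -> : \sum_(k < p) weight k = 2^-1 - 2^-1 ^+ p.+1.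
  by rewrite gerBl exprn_ge0 // invr_ge0 ler0n.
elim: p => [|p IH]; first by rewrite big_ord0 expr1 subrr.
by rewrite big_ord_recr /= IH /weight !exprS; field.
Qed.

(** This telescoping identity is how the fact that successive intervals are
    disjoint enters all counting arguments below. *)
Lemma sum_intervals (T : nat -> nat) n j : {homo T : a b / (a <= b)%N} ->
  \sum_(i < n) ((T i <= j < T i.+1)%N)%:R = ((T 0 <= j < T n)%N)%:R :> R.
Proof.
move=> mT; elim: n => [|n IH]; first by rewrite big_ord0; case: leqP => //=; case: ltnP.
rewrite big_ord_recr /= IH -natrD; congr (_%:R).
have /= h1 := mT 0%N n (leq0n n); have /= h2 := mT n n.+1 (leqnSn n).
by case: (leqP (T 0%N) j) => a; case: (ltnP j (T n)) => b;
  case: (leqP (T n) j) => c; case: (ltnP j (T n.+1)) => d //=; lia.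
Qed.

(** [functional None] generates the norm and [functional (Some k)] the seminorm
    of level k. A single indexed family lets both share one theory of suprema.
    Allowing [f i] to be cut down to the interval [T i, T i.+1) makes closure
    under restriction automatic. *)
Inductive functional : option nat -> (nat -> R) -> Prop :=
| functional_unit i : functional None (fun j => (j == i)%:R)
| functional_node p (g : nat -> nat -> R) :
    (forall k, functional (Some k) (g k)) ->
    functional None (fun j => (p <= j)%N%:R * \sum_(k < p) g k j)
| functional_level k (T : nat -> nat) (f : nat -> nat -> R) :
    {homo T : a b / (a <= b)%N} ->
    (forall i, functional None (f i)) ->
    functional (Some k)
      (fun j => weight k * \sum_(i < arity k) (T i <= j < T i.+1)%N%:R * f i j).

Definition functional_size (l : option nat) : R := if l is Some k then weight k else 1.

Lemma functional_bound l f : functional l f ->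
  forall j, 0 <= f j <= functional_size l.
Proof.
elim=> {l f} [i j|p g _ IH j|k T f mT _ IH j] /=.
- by case: eqP => _ /=; rewrite ?lexx ?ler01.
- have g0 : 0 <= \sum_(k < p) g k j.
    by apply: sumr_ge0 => k _; case/andP: (IH k j).
  have g1 : \sum_(k < p) g k j <= 1.
    have h : \sum_(k < p) g k j <= \sum_(k < p) weight k.
      by apply: ler_sum => k _; case/andP: (IH k j).
    by have := le_trans h (sum_weight p); lra.
  by case: leqP => _ /=; rewrite ?mul1r ?mul0r ?g0 ?g1 ?lexx ?ler01.
- have w0 := weight_gt0 k.
  apply/andP; split.
    apply: mulr_ge0; first exact: ltW.
    apply: sumr_ge0 => i _; rewrite mulr_ge0 ?ler0n //.
    by case/andP: (IH i j).
  rewrite -[leRHS]mulr1 ler_pM2l //.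
  apply: (@le_trans _ _ (\sum_(i < arity k) ((T i <= j < T i.+1)%N)%:R)).
    apply: ler_sum => i _; rewrite ler_piMr ?ler0n //.
    by case/andP: (IH i j).
  by rewrite sum_intervals // lern1 leq_b1.
Qed.

Lemma functional_ge0 l f j : functional l f -> 0 <= f j.
Proof. by move=> /functional_bound/(_ j)/andP[]. Qed.

Lemma functional_le1 l f j : functional l f -> f j <= 1.
Proof.
move=> /functional_bound/(_ j)/andP[_ /le_trans]; apply.
by case: l => [k|] /=; rewrite ?weight_le1.
Qed.

Lemma functional_inh l : exists f, functional l f.
Proof.
case: l => [k|]; last by eexists; exact: (functional_unit 0).
eexists; apply: (@functional_level k (fun=> 0%N) (fun _ j => (j == 0%N)%:R)) => //.
by move=> i; exact: functional_unit.
Qed.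

Lemma functional_nodeP f : functional None f ->
  (exists i, f = fun j => (j == i)%:R) \/
  exists p g, (forall k, functional (Some k) (g k)) /\
     f = fun j => (p <= j)%N%:R * \sum_(k < p) g k j.
Proof.
set l := (X in functional X f) => F.
have : l = None by [].
by case: F => // [i|p g h] _; [left; exists i|right; exists p, g].
Qed.

Lemma functional_levelP k f : functional (Some k) f ->
  exists (T : nat -> nat) (g : nat -> nat -> R),
  [/\ {homo T : a b / (a <= b)%N}, (forall i, functional None (g i)) &
     f = fun j => weight k * \sum_(i < arity k) (T i <= j < T i.+1)%N%:R * g i j].
Proof.
move: {-1}(Some k) (erefl (Some k)) => l lk F.
by case: F lk => // k' T g mT h [->]; exists T, g.
Qed.

(** * The space *)

(** The tails of the sequence tend to 0 in norm. The norm is a supremum that may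
    be infinite for a general sequence, hence the bound uniform over all
    functionals. *)
Definition vanishing : {pred nat -> R^o} := fun v =>
  `[< forall eps : R, 0 < eps -> exists q, forall f n, functional None f ->
        \sum_(q <= j < n) f j * `|v j| <= eps >].

Lemma vanishingP (v : nat -> R^o) :
  reflect (forall eps : R, 0 < eps -> exists q, forall f n, functional None f ->
        \sum_(q <= j < n) f j * `|v j| <= eps) (v \in vanishing).
Proof. exact: asboolP. Qed.

Lemma sum_nat_widen_ge0 (a b a' b' : nat) (u : nat -> R) :
  (forall j, 0 <= u j) -> (a' <= a)%N -> (b <= b')%N ->
  \sum_(a <= j < b) u j <= \sum_(a' <= j < b') u j.
Proof.
move=> u0 aa bb; have [ba|ab] := leqP b a.
  by rewrite big_geq // sumr_ge0.
rewrite (big_cat_nat aa (ltnW (leq_trans ab bb))) /=.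
rewrite (big_cat_nat (ltnW ab) bb) /= addrCA lerDl addr_ge0 //; exact: sumr_ge0.
Qed.

Lemma vanishing_dom (v w : nat -> R^o) : (forall j, `|v j| <= `|w j|) ->
  w \in vanishing -> v \in vanishing.
Proof.
move=> vw /vanishingP h; apply/vanishingP => eps /h[q hq]; exists q => f n F.
apply: le_trans (hq f n F); apply: ler_sum => j _.
by rewrite ler_wpM2l // (functional_ge0 _ F).
Qed.

Lemma vanishing_submod_closed : submod_closed vanishing.
Proof.
split=> [|c v w /vanishingP hv /vanishingP hw]; apply/vanishingP => eps e0.
  exists 0%N => f n F; rewrite big1 ?ltW // => j _.
  by rewrite normr0 mulr0.
have c1 : 0 < `|c| + 1 by rewrite ltr_wpDl.
have [|q1 h1] := hv (eps / 2 / (`|c| + 1)); first by rewrite !divr_gt0.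
have [|q2 h2] := hw (eps / 2); first by rewrite divr_gt0.
exists (maxn q1 q2) => f n F.
have f0 j := functional_ge0 j F.
apply: (@le_trans _ _ (`|c| * \sum_(q1 <= j < n) f j * `|v j| +
                       \sum_(q2 <= j < n) f j * `|w j|)).
  apply: (@le_trans _ _ (\sum_(maxn q1 q2 <= j < n) (`|c| * (f j * `|v j|) + f j * `|w j|))).
    apply: ler_sum => j _; rewrite mulrCA -mulrDr ler_wpM2l //.
    by rewrite -normrM (le_trans (ler_normD _ _)).
  rewrite big_split /= -mulr_sumr lerD //.
    by rewrite ler_wpM2l //; apply: sum_nat_widen_ge0 => [j||];
      rewrite ?leq_maxl ?mulr_ge0.
  by apply: sum_nat_widen_ge0 => [j||]; rewrite ?leq_maxr ?mulr_ge0.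
have := h2 f n F; have := h1 f n F.
set A := \sum_(_ <= j < _) _; set B := \sum_(_ <= j < _) _ => hA hB.
suff : `|c| * A <= eps / 2 by lra.
have h : (`|c| + 1) * A <= eps / 2.
  by rewrite mulrC -ler_pdivlMr.
have A0 : 0 <= A by apply: sumr_ge0 => j _; rewrite mulr_ge0.
by apply: le_trans h; rewrite ler_wpM2r // lerDl.
Qed.

HB.instance Definition _ :=
  GRing.isSubmodClosed.Build R (nat -> R^o) vanishing vanishing_submod_closed.

Record space := Space { coord :> nat -> R^o ; _ : coord \in vanishing }.

HB.instance Definition _ := [isSub for coord].
HB.instance Definition _ := [Choice of space by <:].
HB.instance Definition _ := [SubChoice_isSubLmodule of space by <:].

Definition seminorm (l : option nat) (v : space) : R :=
  sup [set t | exists f n, functional l f /\ t = \sum_(0 <= j < n) f j * `|v j|].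

Lemma seminorm_le l (v : space) B :
  (forall f n, functional l f -> \sum_(0 <= j < n) f j * `|v j| <= B) ->
  seminorm l v <= B.
Proof.
move=> h; apply: ge_sup.
  by have [f F] := functional_inh l; exists (\sum_(0 <= j < 0) f j * `|v j|); exists f, 0%N.
by move=> _ [f [n [F ->]]]; exact: h.
Qed.

(** Finiteness of the seminorms: the tail is bounded by membership in the space
    and the finitely many remaining coordinates by their absolute values. A
    level is at most a finite multiple of the norm. *)
Lemma functional_bounded l (v : space) : exists B : R, forall f n, functional l f ->
  \sum_(0 <= j < n) f j * `|v j| <= B.
Proof.
have bN : exists B : R, forall f n, functional None f ->
    \sum_(0 <= j < n) f j * `|v j| <= B.
  have /vanishingP/(_ 1 ltr01)[q hq] := valP v.
  exists (\sum_(0 <= j < q) `|v j| + 1) => f n F.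
  have f0 j := functional_ge0 j F.
  apply: (@le_trans _ _ (\sum_(0 <= j < maxn q n) f j * `|v j|)).
    by apply: sum_nat_widen_ge0 => [j||]; rewrite ?leq_maxr ?mulr_ge0.
  rewrite (big_cat_nat (leq0n q) (leq_maxl q n)) /= lerD //; last exact: hq.
  apply: ler_sum => j _; rewrite ler_piMl //; exact: functional_le1 F.
case: l => // k.
have [B hB] := bN; exists (weight k * (B *+ arity k)) => _ n /functional_levelP[T [g [mT G ->]]].
under eq_bigr do rewrite -mulrA mulr_suml.
rewrite -mulr_sumr ler_wpM2l ?(ltW (weight_gt0 k)) //.
rewrite exchange_big /=.
have -> : B *+ arity k = \sum_(i < arity k) B by rewrite sumr_const card_ord.
apply: ler_sum => i _.
apply: le_trans (hB _ n (G i)); apply: ler_sum => j _.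
rewrite ler_wpM2r //; case: (_ && _); rewrite ?mul1r ?mul0r ?lexx //.
exact: functional_ge0 (G i).
Qed.

Lemma seminorm_ge l (v : space) f n : functional l f ->
  \sum_(0 <= j < n) f j * `|v j| <= seminorm l v.
Proof.
move=> F; apply: ub_le_sup; last by exists f, n.
by have [B hB] := functional_bounded l v; exists B => _ [g [m [G ->]]]; exact: hB.
Qed.

Lemma seminorm_approx l (v : space) eps : 0 < eps ->
  exists f n, functional l f /\
    seminorm l v - eps <= \sum_(0 <= j < n) f j * `|v j|.
Proof.
move=> e0; apply: contrapT => h.
have : seminorm l v <= seminorm l v - eps.
  apply: seminorm_le => f n F; rewrite leNgt; apply/negP => lt.
  by apply: h; exists f, n; split => //; exact: ltW.
by lra.
Qed.

Lemma seminorm_ge0 l v : 0 <= seminorm l v.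
Proof.
have [f F] := functional_inh l.
by apply: le_trans (seminorm_ge v 0 F); rewrite big_nil.
Qed.

Lemma seminorm_mono l (v w : space) : (forall j, `|v j| <= `|w j|) ->
  seminorm l v <= seminorm l w.
Proof.
move=> vw; apply: seminorm_le => f n F; apply: le_trans (seminorm_ge w n F).
by apply: ler_sum => j _; rewrite ler_wpM2l // (functional_ge0 _ F).
Qed.

Lemma seminormD l v w : seminorm l (v + w) <= seminorm l v + seminorm l w.
Proof.
apply: seminorm_le => f n F.
apply: le_trans (lerD (seminorm_ge v n F) (seminorm_ge w n F)).
rewrite -big_split /= ler_sum // => j _.
by rewrite -mulrDr ler_wpM2l ?ler_normD // (functional_ge0 _ F).
Qed.

Lemma seminormZ l (c : R) v : seminorm l (c *: v) = `|c| * seminorm l v.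
Proof.
have le a (u : space) : seminorm l (a *: u) <= `|a| * seminorm l u.
  apply: seminorm_le => f n F.
  apply: le_trans (ler_wpM2l (normr_ge0 a) (seminorm_ge u n F)).
  by rewrite mulr_sumr ler_sum // => j _; rewrite mulrCA [`|(a *: u) j|]normrM.
have [->|c0] := eqVneq c 0.
  apply/eqP; rewrite normr0 mul0r eq_le seminorm_ge0 andbT.
  by apply: le_trans (le 0 v) _; rewrite normr0 mul0r.
apply/eqP; rewrite eq_le le /=.
have := le c^-1 (c *: v); rewrite scalerA mulVf // scale1r normfV => h.
by rewrite -ler_pdivlMl ?normr_gt0.
Qed.

Lemma coord_le (v : space) j : `|v j| <= seminorm None v.
Proof.
apply: le_trans (seminorm_ge v j.+1 (functional_unit j)).
by rewrite big_nat_recr //= eqxx mul1r lerDr sumr_ge0.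
Qed.

Lemma seminorm_eq0 v : seminorm None v = 0 -> v = 0.
Proof.
move=> v0; apply/val_inj/funext => j /=; apply/eqP.
by rewrite -normr_le0 -v0 coord_le.
Qed.

HB.instance Definition _ :=
  Lmodule_isNormed.Build R space (@seminormD None) (@seminormZ None) seminorm_eq0.

Lemma space_normE (v : space) : `|v| = seminorm None v.
Proof. by []. Qed.

(** The coordinates of a Cauchy filter converge, and each functional, being a
    finite sum of coordinates, passes to the limit. The bounds are uniform in
    the functional, which gives convergence in norm. *)
Lemma space_cauchy_cvg (F : set_system space) :
  ProperFilter F -> cauchy F -> cvg F.
Proof.
move=> FF /cauchyP cF.
have near e : 0 < e -> exists A, F A /\ forall u w, A u -> A w -> `|u - w| <= e.
  move=> e0; have [|x Fx] := cF (e / 2); first exact: divr_gt0.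
  exists (ball x (e / 2)); split=> // u w.
  rewrite -!ball_normE /= => xu xw; apply/ltW.
  rewrite (_ : u - w = (x - w) - (x - u)); last by rewrite opprB [RHS]addrC addrA subrK.
  by apply: le_lt_trans (ler_normB _ _) _; rewrite [e]splitr ltrD.
have cvgj j : cvg ((fun v : space => v j : R) @ F).
  apply/cauchy_cvgP/cauchyP => e e0.
  have [|A [FA hA]] := near (e / 2); first exact: divr_gt0.
  have [u Au] := filter_ex FA; exists (u j).
  apply: (@filterS _ F _ A) => // w Aw; rewrite -ball_normE /=.
  apply: (@le_lt_trans _ _ (e / 2)); last by rewrite gtr_pMr // invf_lt1 // ltr1n.
  exact: le_trans (coord_le (u - w) j) (hA _ _ Au Aw).
pose v j : R^o := lim ((fun v : space => v j : R) @ F).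
have lim_le A e : F A -> (forall u w, A u -> A w -> `|u - w| <= e) ->
    forall u, A u -> forall f n, functional None f ->
    \sum_(0 <= j < n) f j * `|u j - v j| <= e.
  move=> FA hA u Au f n G.
  have cv : (fun w : space => \sum_(0 <= j < n) f j * `|u j - w j|) @ F -->
      \sum_(0 <= j < n) f j * `|u j - v j|.
    apply: cvg_big => [|j _]; first exact: add_continuous.
    apply: cvgM; first exact: cvg_cst.
    apply: cvg_norm; apply: cvgB; first exact: cvg_cst.
    exact: cvgj.
  apply: (cvgr_to_le cv).
  apply: (@filterS _ F _ A) => // w Aw.
  apply: le_trans (hA _ _ Au Aw); exact: (@seminorm_ge None (u - w)).
have vP : v \in vanishing.
  apply/vanishingP => e e0.
  have [|A [FA hA]] := near (e / 2); first exact: divr_gt0.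
  have [u Au] := filter_ex FA.
  have /vanishingP/(_ (e / 2))[|q hq] := valP u; first exact: divr_gt0.
  exists q => f n G; have f0 j := functional_ge0 j G.
  rewrite [e]splitr.
  apply: le_trans (lerD (hq f n G) (lim_le _ _ FA hA u Au f n G)).
  apply: (@le_trans _ _ (\sum_(q <= j < n) (f j * `|u j| + f j * `|u j - v j|))).
    apply: ler_sum => j _; rewrite -mulrDr ler_wpM2l //.
    by rewrite -lerBlDl -(distrC (v j)) lerB_dist.
  by rewrite big_split /= lerD2l; apply: sum_nat_widen_ge0 => // j; rewrite mulr_ge0.
apply/cvg_ex; exists (Space vP); apply/cvgrPdist_le => e e0.
have [A [FA hA]] := near e e0.
apply: (@filterS _ F _ A) => // u Au /=; rewrite distrC space_normE.
by apply: seminorm_le => f n G; exact: lim_le FA hA u Au f n G.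
Qed.

HB.instance Definition _ := Uniform_isComplete.Build space space_cauchy_cvg.

End Functionals.

Local Notation lev k := (seminorm (Some (k : nat))).

(** * The implicit equation of the norm *)

Section Estimates.
Context (R : realType).
Implicit Types (v w : space R) (k : nat).

Lemma norm_mono v w : (forall j, `|v j| <= `|w j|) -> `|v| <= `|w|.
Proof. exact: seminorm_mono. Qed.

Lemma coord_norm v j : `|v j| <= `|v|.
Proof. exact: coord_le. Qed.

Lemma space_eq v w : (forall j, v j = w j) -> v = w.
Proof. by move=> vw; apply/val_inj/funext. Qed.

Lemma coordZ (c : R) v j : (c *: v) j = c * v j.
Proof. by []. Qed.

Lemma coord_sum (I : Type) (r : seq I) (P : pred I) (u : I -> space R) j :
  (\sum_(i <- r | P i) u i) j = \sum_(i <- r | P i) (u i j : R).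
Proof. by elim/big_rec2 : _ => // i x y _ <-. Qed.

Lemma seminorm0 l : seminorm l (0 : space R) = 0.
Proof. by rewrite -(scale0r (0 : space R)) seminormZ normr0 mul0r. Qed.

Lemma seminorm_sum (I : Type) (r : seq I) (P : pred I) l (u : I -> space R) :
  seminorm l (\sum_(i <- r | P i) u i) <= \sum_(i <- r | P i) seminorm l (u i).
Proof.
elim/big_rec2 : _ => [|i x y _ h]; first by rewrite seminorm0.
by apply: le_trans (seminormD _ _ _) _; rewrite lerD2l.
Qed.

Lemma mask_subproof (P : pred nat) v :
  (fun j => (P j)%:R * v j : R^o) \in @vanishing R.
Proof.
apply: vanishing_dom (valP v) => j.
by case: (P j); rewrite ?mul1r // mul0r normr0.
Qed.

Definition mask (P : pred nat) v : space R := Space (mask_subproof P v).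

Lemma maskE P v j : mask P v j = (P j)%:R * v j.
Proof. by []. Qed.

Lemma mask_le P v j : `|mask P v j| <= `|v j|.
Proof. by rewrite maskE; case: (P j); rewrite ?mul1r // mul0r normr0. Qed.

Lemma maskD P v w : mask P (v + w) = mask P v + mask P w.
Proof. by apply: space_eq => j /=; rewrite mulrDr. Qed.

Lemma mask0 P : mask P 0 = 0.
Proof. by apply: space_eq => j /=; rewrite mulr0. Qed.

Lemma mask_sum P (I : Type) (r : seq I) (Q : pred I) (u : I -> space R) :
  mask P (\sum_(i <- r | Q i) u i) = \sum_(i <- r | Q i) mask P (u i).
Proof.
by elim/big_rec2 : _ => [|i x y _ <-]; rewrite ?mask0 ?maskD.
Qed.

(** A sum of finitely many suprema is bounded as soon as all simultaneous
    choices of functionals are. Taking a common truncation [m] is harmless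
    because all terms are nonnegative. *)
Lemma sum_seminorm_le n (l : nat -> option nat) (v : nat -> space R) (B : R) :
  (forall (f : nat -> nat -> R) m, (forall i, functional (l i) (f i)) ->
     \sum_(i < n) \sum_(0 <= j < m) f i j * `|v i j| <= B) ->
  \sum_(i < n) seminorm (l i) (v i) <= B.
Proof.
move=> h; apply/ler_addgt0Pr => e e0.
have e1 : 0 < e / n.+1%:R by rewrite divr_gt0.
have /choice[fm hfm] : forall i, exists fm : (nat -> R) * nat,
    functional (l i) fm.1 /\ seminorm (l i) (v i) - e / n.+1%:R <=
      \sum_(0 <= j < fm.2) fm.1 j * `|v i j|.
  by move=> i; have [f [m [F hf]]] := seminorm_approx (l i) (v i) e1; exists (f, m).
pose m := (\max_(i < n) (fm i).2)%N.
apply: (@le_trans _ _ (\sum_(i < n)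
    ((\sum_(0 <= j < m) (fm i).1 j * `|v i j|) + e / n.+1%:R))).
  apply: ler_sum => i _; have [F hf] := hfm i.
  rewrite -lerBlDr; apply: le_trans hf _.
  apply: sum_nat_widen_ge0 => // [j|]; first by rewrite mulr_ge0 // (functional_ge0 _ F).
  exact: (@leq_bigmax _ (fun i : 'I_n => (fm i).2) i).
rewrite big_split /= lerD //; first by apply: (h (fun i => (fm i).1) m) => i; have [] := hfm i.
rewrite sumr_const card_ord -(mulr_natr (e / _)) mulrAC ler_pdivrMr ?ltr0n //.
by rewrite ler_pM2l // ler_nat.
Qed.

(** The node built from almost optimal functionals of the levels below [p]
    vanishes only where [v] does. *)
Lemma sum_lev_le p v : (forall j, (j < p)%N -> v j = 0) ->
  \sum_(k < p) lev k v <= `|v|.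
Proof.
move=> v0; apply: (@sum_seminorm_le p Some (fun=> v)) => f m F.
rewrite exchange_big /=.
apply: le_trans (seminorm_ge v m (functional_node p F)).
apply: ler_sum => j _; rewrite -mulr_suml.
by case: (leqP p j) => [_|/v0 ->]; rewrite ?mul1r // normr0 !mulr0.
Qed.

(** The intervals of the level may be chosen to separate the [u i]. *)
Lemma lev_ge k (T : nat -> nat) (u : nat -> space R) v :
  {homo T : a b / (a <= b)%N} ->
  (forall i j, ~~ (T i <= j < T i.+1)%N -> u i j = 0) ->
  (forall i j, `|u i j| <= `|v j|) ->
  weight R k * \sum_(i < arity k) `|u i| <= lev k v.
Proof.
move=> mT u0 uv; rewrite -ler_pdivlMl ?weight_gt0 //.
apply: (@sum_seminorm_le (arity k) (fun=> None) u) => f m F.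
rewrite ler_pdivlMl ?weight_gt0 //.
apply: le_trans (seminorm_ge v m (functional_level k mT F)).
rewrite exchange_big mulr_sumr /= ler_sum // => j _.
rewrite -mulrA ler_pM2l ?weight_gt0 // mulr_suml ler_sum // => i _.
have := u0 i j; case: (_ && _) => [_|->//]; rewrite ?mul1r ?normr0 ?mulr0 ?mul0r //.
by rewrite ler_wpM2l // (functional_ge0 _ (F i)).
Qed.

(** A norming functional either evaluates one coordinate, or is a node. *)
Lemma norm_le_lev v (B : R) : (forall j, `|v j| <= B) ->
  (forall p, \sum_(k < p) lev k (mask (leq p) v) <= B) -> `|v| <= B.
Proof.
move=> vB levB; apply: seminorm_le => f n /functional_nodeP[[i ->]|[p [g [G ->]]]].
  have B0 : 0 <= B by apply: le_trans (vB 0%N).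
  have [ni|ni] := leqP n i.
    rewrite big1_seq // => j /andP[_]; rewrite mem_index_iota => /andP[_ jn].
    by rewrite ltn_eqF ?mul0r // (leq_trans jn).
  rewrite (bigD1_seq i) ?mem_index_iota ?iota_uniq //= eqxx mul1r big1 ?addr0 //.
  by move=> j /negPf ->; rewrite mul0r.
apply: le_trans (levB p).
apply: (@le_trans _ _ (\sum_(k < p) \sum_(0 <= j < n) g k j * `|mask (leq p) v j|)).
  rewrite exchange_big /= ler_sum // => j _.
  rewrite normrM normr_nat -mulr_suml.
  by rewrite mulrA [in leRHS](mulrC (\sum_(_ < _) _)).
apply: ler_sum => k _; exact: seminorm_ge.
Qed.

Lemma disjoint_sum_coord n (T : nat -> nat) (u : nat -> space R) i j :
  {homo T : a b / (a <= b)%N} ->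
  (forall i j, ~~ (T i <= j < T i.+1)%N -> u i j = 0) -> (i < n)%N ->
  `|u i j| <= `|(\sum_(l < n) u l) j|.
Proof.
move=> mT u0 ilt; have [h|/u0 ->] := boolP (T i <= j < T i.+1)%N; last first.
  by rewrite normr0.
rewrite coord_sum (bigD1 (Ordinal ilt)) //= big1 ?addr0 // => l li; apply: u0.
have {}li : val l != i by [].
apply/negP => h'; case: (ltngtP (val l) i) li => // /mT /= h2 _; move: h h' h2; lia.
Qed.

(** [N] successive blocks and [arity k] successive intervals have at most
    [N + arity k] incidences. When [N] is much larger than [arity k] this makes
    the level almost as small on an average as its weight. *)
Lemma lev_le_blocks k N (Q : nat -> nat) (u : nat -> space R) (B : R) :
  {homo Q : a b / (a <= b)%N} ->
  (forall r j, ~~ (Q r <= j < Q r.+1)%N -> u r j = 0) ->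
  (forall r, (r < N)%N -> `|u r| <= B) -> 0 <= B ->
  lev k (\sum_(r < N) u r) <= weight R k * (N%:R + (arity k)%:R) * B.
Proof.
move=> mQ u0 uB B0; apply: seminorm_le => _ n /functional_levelP[T [f [mT F ->]]].
have f0 i j := functional_ge0 j (F i).
(* the first common point of an interval and a block is the left end of one of
   the two; d counts these possibilities *)
pose d i r : R := (Q r <= T i < Q r.+1)%N%:R + (T i <= Q r < T i.+1)%N%:R.
have d0 i r : 0 <= d i r by rewrite addr_ge0.
have meet i r : (r < N)%N ->
    \sum_(0 <= j < n) (T i <= j < T i.+1)%N%:R * f i j * `|u r j| <= d i r * B.
  move=> rN; have [h|h] := boolP ((Q r <= T i < Q r.+1) || (T i <= Q r < T i.+1))%N.
    apply: (@le_trans _ _ `|u r|).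
      apply: le_trans (seminorm_ge (u r) n (F i)); apply: ler_sum => j _.
      by rewrite ler_wpM2r //; case: (_ && _); rewrite ?mul1r // mul0r f0.
    apply: le_trans (uB r rN) _; rewrite ler_peMl // /d -natrD ler1n.
    by case/orP: h => ->; rewrite ?addn1.
  rewrite big1 ?mulr_ge0 // => j _.
  have [hT|hT] := boolP (T i <= j < T i.+1)%N; last by rewrite !mul0r.
  by rewrite (u0 r j) ?normr0 ?mulr0 //; move: h hT; lia.
apply: (@le_trans _ _ (weight R k * \sum_(i < arity k) \sum_(r < N) d i r * B)).
  under eq_bigr do rewrite -mulrA.
  rewrite -mulr_sumr ler_pM2l ?weight_gt0 //.
  under eq_bigr do rewrite mulr_suml.
  rewrite exchange_big /= ler_sum // => i _.
  apply: le_trans (ler_sum _ (fun r _ => meet i (val r) (ltn_ord r))).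
  rewrite exchange_big /= ler_sum // => j _.
  rewrite coord_sum -mulr_sumr ler_wpM2l ?mulr_ge0 //.
  exact: ler_norm_sum.
rewrite -mulrA ler_pM2l ?weight_gt0 //.
under eq_bigr do rewrite -mulr_suml.
rewrite -mulr_suml ler_wpM2r //.
under eq_bigr do rewrite big_split /=.
rewrite big_split /= addrC lerD //.
  rewrite exchange_big /=.
  have -> : N%:R = \sum_(r < N) 1 :> R by rewrite sumr_const card_ord.
  apply: ler_sum => r _.
  by rewrite sum_intervals // lern1 leq_b1.
have -> : (arity k)%:R = \sum_(i < arity k) 1 :> R by rewrite sumr_const card_ord.
apply: ler_sum => i _.
by rewrite sum_intervals // lern1 leq_b1.
Qed.

End Estimates.

(** * The unit vector basis *)

Section Basis.
Context (R : realType).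

Lemma evec_subproof (i : nat) : (fun j => (j == i)%:R : R^o) \in @vanishing R.
Proof.
apply/vanishingP => e e0; exists i.+1 => f n F.
rewrite big1_seq ?ltW // => j /andP[_]; rewrite mem_index_iota => /andP[ij _].
by rewrite gtn_eqF ?normr0 ?mulr0.
Qed.

Definition evec (i : nat) : space R := Space (evec_subproof i).

Lemma evecE i j : evec i j = (j == i)%:R.
Proof. by []. Qed.

Lemma sum_evecE (a : nat -> R) m n j :
  (\sum_(m <= i < n) a i *: evec i) j = (m <= j < n)%N%:R * a j.
Proof.
rewrite coord_sum; have [h|h] := boolP (m <= j < n)%N.
  rewrite (bigD1_seq j) ?mem_index_iota ?iota_uniq // big1 ?addr0; last first.
    by move=> i ij; rewrite coordZ evecE eq_sym (negPf ij) mulr0.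
  by rewrite coordZ evecE eqxx /= addr0 mulr1 mul1r.
rewrite mul0r big1_seq // => i /andP[_]; rewrite mem_index_iota coordZ evecE.
by case: eqP => [<-|_ _]; rewrite ?(negPf h) ?mulr0.
Qed.

Lemma evec_normalized : normalized evec.
Proof.
move=> i; apply/eqP; rewrite eq_le; apply/andP; split; last first.
  by apply: le_trans (coord_norm _ i); rewrite evecE eqxx normr1.
apply: seminorm_le => f n F.
have [ni|ni] := leqP n i.
  rewrite big1_seq // => j /andP[_]; rewrite mem_index_iota evecE => /andP[_ jn].
  by rewrite ltn_eqF ?normr0 ?mulr0 // (leq_trans jn).
rewrite (bigD1_seq i) ?mem_index_iota ?iota_uniq //= eqxx normr1 mulr1.
rewrite big1 ?addr0; first exact: functional_le1 F.
by move=> j /negPf ji; rewrite /= ji normr0 mulr0.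
Qed.

Lemma evec_unconditional : one_unconditional evec.
Proof.
move=> n a s; apply: norm_mono => j.
have E (b : nat -> R) :
    \sum_(i < n) b i *: evec i = \sum_(0 <= i < n) b i *: evec i.
  by rewrite big_mkord.
rewrite (E (fun i => (-1) ^+ s i * a i)) (E a).
rewrite (sum_evecE (fun i => (-1) ^+ s i * a i)) sum_evecE !normrM.
by rewrite normrX normrN1 expr1n mul1r.
Qed.

Lemma evec_basis : schauder_basis evec.
Proof.
split=> // v _; exists (v : nat -> R); split.
  apply/cvgrPdist_le => e e0.
  have /vanishingP/(_ e e0)[q hq] := valP v.
  exists q => // n /= qn.
  have -> : v - series (fun i => v i *: evec i) n = mask (leq n) v.
    apply: space_eq => j; rewrite /series maskE.
    rewrite [LHS](_ : _ = v j - (\sum_(0 <= i < n) v i *: evec i) j) //.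
    by rewrite sum_evecE /=; case: ltnP => _; rewrite ?mul1r ?mul0r ?subrr ?subr0.
  apply: seminorm_le => f m F.
  apply: le_trans (hq f m F).
  have [mq|qm] := leqP m q.
    rewrite [leRHS]big_geq // big1_seq // => j /andP[_]; rewrite mem_index_iota maskE => /= jm.
    by rewrite leqNgt (leq_trans jm) ?mul0r ?normr0 ?mulr0 // (leq_trans mq).
  rewrite (big_cat_nat (leq0n q) (ltnW qm)) /= big1_seq ?add0r.
    by apply: ler_sum => j _; rewrite ler_wpM2l ?mask_le // (functional_ge0 _ F).
  move=> j /andP[_]; rewrite mem_index_iota => /= jq.
  by rewrite leqNgt (leq_trans jq) ?mul0r ?normr0 ?mulr0.
move=> a /cvgrPdist_le h; apply/funext => j; apply/eqP.
rewrite -subr_eq0 -normr_le0; apply/ler_addgt0Pr => e e0; rewrite add0r.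
have [n _ hn] := h e e0.
have := hn (maxn n j.+1) (leq_maxl _ _); apply: le_trans.
apply: le_trans (coord_norm _ j).
rewrite /series /= [X in _ <= `|X|](_ : _ = v j - (\sum_(0 <= i < maxn n j.+1) a i *: evec i) j) //.
by rewrite sum_evecE /= leq_maxr mul1r.
Qed.

End Basis.

(** * Block sequences *)

Section Blocks.
Context (R : realType).
Implicit Types (x : nat -> space R) (q k : nat -> nat).

(** The interval [q i, q i.+1) may exceed the support of [x i], so that the
    notion is inherited by subsequences. *)
Definition blocks x q : Prop :=
  [/\ {homo q : i j / (i < j)%N}, forall j, `|x j| = 1 &
      forall i j, ~~ (q i <= j < q i.+1)%N -> x i j = 0].

Lemma homo_leq_geq k : {homo k : i j / (i < j)%N} -> forall i, (i <= k i)%N.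
Proof. by move=> hk; elim=> // i /leq_ltn_trans; apply; exact: hk. Qed.

Lemma homo_ltW k : {homo k : i j / (i < j)%N} -> {homo k : i j / (i <= j)%N}.
Proof.
move=> hk i j; rewrite leq_eqVlt => /orP[/eqP->//|/hk]; exact: ltnW.
Qed.

Lemma block_basis_blocks x :
  block_basis (@evec R) x -> normalized x -> exists q, blocks x q.
Proof.
move=> [_ [p [a [hp xE]]]] x1; exists p; split => //.
  by move=> i j ij; apply: (homo_ltn (r := fun a b => (a < b)%N)) => //; exact: ltn_trans.
by move=> i j /negPf h; rewrite xE sum_evecE h mul0r.
Qed.

Lemma sum_blocks_disjoint (q k : nat -> nat) n j :
  {homo q : i j / (i < j)%N} -> {homo k : i j / (i < j)%N} ->
  \sum_(i < n) (q (k i) <= j < q (k i).+1)%N%:R <= 1 :> R.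
Proof.
move=> hq hk.
apply: (@le_trans _ _ (\sum_(i < n) (q (k i) <= j < q (k i.+1))%N%:R)).
  apply: ler_sum => i _; rewrite ler_nat.
  have /= := homo_ltW hq (hk i i.+1 (ltnSn i)).
  case: (_ <= j)%N => //=; case: ltnP => // h1 h2.
  by rewrite (leq_trans h1 h2).
rewrite (@sum_intervals _ (q \o k)) ?lern1 ?leq_b1 // => i i' ii'.
exact: homo_ltW hq _ _ (homo_ltW hk ii').
Qed.

Section OneBlockSequence.
Variables (x : nat -> space R) (q : nat -> nat).
Hypothesis bx : blocks x q.

Let hq : {homo q : i j / (i < j)%N}. Proof. by case: bx. Qed.
Let x1 j : `|x j| = 1. Proof. by case: bx. Qed.
Let x0 i j : ~~ (q i <= j < q i.+1)%N -> x i j = 0. Proof. by case: bx => _ _; exact. Qed.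

Lemma blocks_sub k : {homo k : i j / (i < j)%N} ->
  forall i j, ~~ (q (k i) <= j < q (k i.+1))%N -> x (k i) j = 0.
Proof.
move=> hk i j h; apply: x0; apply: contra h => /andP[-> h] /=.
exact: leq_trans h (homo_ltW hq (hk i i.+1 (ltnSn i))).
Qed.

Lemma homo_comp k : {homo k : i j / (i < j)%N} -> {homo q \o k : i j / (i <= j)%N}.
Proof. by move=> hk i j ij; exact: homo_ltW hq _ _ (homo_ltW hk ij). Qed.

Lemma blocks_sum_coord k n i j : {homo k : i j / (i < j)%N} -> (i < n)%N ->
  `|x (k i) j| <= `|(\sum_(l < n) x (k l)) j|.
Proof.
move=> hk; apply: (@disjoint_sum_coord _ n (q \o k) (fun i => x (k i))).
  exact: homo_comp.
exact: blocks_sub.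
Qed.

Lemma blocks_sum_ge1 k n : {homo k : i j / (i < j)%N} -> (0 < n)%N ->
  1 <= `|\sum_(i < n) x (k i)|.
Proof.
by move=> hk n0; rewrite -(x1 (k 0%N)); apply: norm_mono => j; exact: blocks_sum_coord.
Qed.

Lemma lev_le_norm i p : (p <= q i)%N -> \sum_(k < p) lev k (x i) <= 1.
Proof.
move=> pi; rewrite -(x1 i); apply: sum_lev_le => j jp; apply: x0.
by rewrite negb_and -ltnNge (leq_trans jp pi).
Qed.

(** Only level [l] is used: its intervals separate the terms, and it is
    available because the sum starts after [l]. *)
Lemma blocks_sum_lower k l : {homo k : i j / (i < j)%N} -> (l < q (k 0%N))%N ->
  weight R l * (arity l)%:R <= `|\sum_(i < arity l) x (k i)|.
Proof.
move=> hk lq; set z := \sum_(i < _) _.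
have zsupp j : (j < l.+1)%N -> z j = 0.
  move=> jl; rewrite coord_sum big1 // => i _; apply: x0.
  have := homo_ltW hq (homo_ltW hk (leq0n i)); rewrite /= => h.
  by rewrite negb_and -ltnNge (leq_trans jl) // (leq_trans lq).
apply: le_trans (sum_lev_le zsupp).
rewrite big_ord_recr /= ler_wpDl ?sumr_ge0 // => [i _|]; first exact: seminorm_ge0.
have -> : (arity l)%:R = \sum_(i < arity l) `|if (i < arity l)%N then x (k i) else 0| :> R.
  rewrite -[LHS](@mulr_natl R) mulr1 -[X in _ *+ X]card_ord -sumr_const.
  by apply: eq_bigr => i _; rewrite ltn_ord x1.
apply: (@lev_ge _ l (q \o k) (fun i => if (i < arity l)%N then x (k i) else 0)).
- exact: homo_comp.
- by move=> i j h; case: ifP => // _; exact: (blocks_sub hk).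
- move=> i j; case: ifP => [il|_]; last by rewrite normr0.
  exact: blocks_sum_coord.
Qed.

Lemma sum_group (V : zmodType) (F : nat -> V) N m :
  \sum_(i < N * m) F i = \sum_(r < N) \sum_(i < m) F (r * m + i)%N.
Proof.
elim: N => [|N IH]; first by rewrite !big_ord0.
rewrite big_ord_recr /= -IH -!(big_mkord xpredT) mulSn addnC.
rewrite (big_cat_nat (leq0n (N * m)%N)) ?leq_addr //=; congr (_ + _).
rewrite -{1}[(N * m)%N]add0n big_addn addKn -(big_mkord xpredT (fun i => F (N * m + i)%N)).
by apply: eq_bigr => i _; rewrite addnC.
Qed.

Lemma lev_sum_groups k l N m B : {homo k : i j / (i < j)%N} -> (0 < m)%N ->
  (forall r, (r < N)%N -> `|\sum_(i < m) x (k (r * m + i)%N)| <= B) -> 0 <= B ->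
  lev l (\sum_(i < N * m) x (k i)) <= weight R l * (N%:R + (arity l)%:R) * B.
Proof.
move=> hk m0 hB B0; rewrite (sum_group (fun i => x (k i))).
apply: (@lev_le_blocks _ l N (fun r => q (k (r * m)%N))
  (fun r => \sum_(i < m) x (k (r * m + i)%N))) => //.
  by move=> r r' rr'; apply: homo_ltW hq _ _ (homo_ltW hk _); rewrite leq_mul2r rr' orbT.
move=> r j h; rewrite coord_sum big1 // => i _; apply: x0; apply: contra h.
move=> /andP[h1 h2]; apply/andP; split.
  by apply: leq_trans h1; apply: homo_ltW hq _ _ (homo_ltW hk _); rewrite leq_addr.
apply: leq_trans h2 _; apply: (homo_ltW hq); apply: hk.
by rewrite mulSn addnC ltn_add2r.
Qed.

End OneBlockSequence.

Section Tame.
Variables (x : nat -> space R) (q K : nat -> nat).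

(** The levels below [q j] are those available to a node that starts before the
    [j]-th term, hence possibly in the preceding one. Beyond [K r] they
    contribute at most 1 / (r + 1) on each late term. *)
Definition tame : Prop := forall r j, (r <= j)%N ->
  \sum_(K r <= l < q j) lev l (x j) <= r.+1%:R^-1.

Hypotheses (bx : blocks x q) (tx : tame).

Let hq : {homo q : i j / (i < j)%N}. Proof. by case: bx. Qed.
Let x1 j : `|x j| = 1. Proof. by case: bx. Qed.
Let x0 i j : ~~ (q i <= j < q i.+1)%N -> x i j = 0. Proof. by case: bx => _ _; exact. Qed.

(** A node starting after the [i]-th term does not see it, one starting before
    it is controlled by tameness, and only one starting inside it can use the
    full norm of the term. *)
Lemma tame_masked r i p : (r <= i)%N ->
  \sum_(K r <= l < p) lev l (mask (leq p) (x i)) <=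
  r.+1%:R^-1 + (q i <= p < q i.+1)%N%:R.
Proof.
move=> ri; have [pq|qp] := ltnP p (q i).
  rewrite /= addr0; apply: le_trans (tx ri).
  apply: (@le_trans _ _ (\sum_(K r <= l < p) lev l (x i))).
    by apply: ler_sum => l _; apply: seminorm_mono => j; exact: mask_le.
  by apply: sum_nat_widen_ge0 => // [l|]; [exact: seminorm_ge0|exact: ltnW].
have [pq|pq] := ltnP p (q i.+1); last first.
  rewrite big1 => [|l _]; first by rewrite addr0 invr_ge0.
  rewrite (_ : mask _ _ = 0) ?seminorm0 //; apply: space_eq => j.
  rewrite maskE; case: leqP => [pj|_]; last by rewrite mul0r.
  by rewrite mul1r x0 // negb_and -leqNgt (leq_trans pq pj) orbT.
apply: (@le_trans _ _ 1); last by rewrite lerDr invr_ge0.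
apply: (@le_trans _ _ (\sum_(l < p) lev l (mask (leq p) (x i)))).
  rewrite -(big_mkord xpredT (fun l => lev l (mask (leq p) (x i)))).
  by apply: sum_nat_widen_ge0 => // l; exact: seminorm_ge0.
apply: (@le_trans _ _ `|mask (leq p) (x i)|).
  by apply: sum_lev_le => j jp; rewrite maskE leqNgt jp mul0r.
by rewrite -(x1 i); apply: norm_mono => j; exact: mask_le.
Qed.

(** The levels from [K r] on act term by term: a node starts inside at most one
    term of the sum, which costs 1, and every other term costs at most
    1 / (r + 1). *)
Lemma tame_upper r k n (z := \sum_(i < n) x (k i)) :
  {homo k : i j / (i < j)%N} -> (r <= k 0%N)%N ->
  `|z| <= \sum_(l < K r) lev l z + n%:R / r.+1%:R + 1.
Proof.
move=> hk rk.
have S0 : 0 <= \sum_(l < K r) lev l z by apply: sumr_ge0 => l _; exact: seminorm_ge0.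
have n0 : 0 <= n%:R / r.+1%:R :> R by rewrite divr_ge0.
apply: norm_le_lev => [j|p].
  apply: (@le_trans _ _ 1); last by rewrite lerDr addr_ge0.
  apply: le_trans (sum_blocks_disjoint n j hq hk).
  rewrite coord_sum; apply: le_trans (ler_norm_sum _ _ _) _; apply: ler_sum => i _.
  have [h|/x0 ->] := boolP (_ <= _ < _)%N; last by rewrite normr0.
  by rewrite -(x1 (k i)); exact: coord_norm.
have zle : \sum_(l < K r) lev l (mask (leq p) z) <= \sum_(l < K r) lev l z.
  by apply: ler_sum => l _; apply: seminorm_mono => j; exact: mask_le.
have [pK|Kp] := leqP p (K r).
  apply: (@le_trans _ _ (\sum_(l < K r) lev l (mask (leq p) z))); last first.
    by apply: le_trans zle _; rewrite -addrA lerDl addr_ge0.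
  rewrite -!(big_mkord xpredT (fun l => lev l (mask (leq p) z))).
  by apply: sum_nat_widen_ge0 => // l; exact: seminorm_ge0.
rewrite -(big_mkord xpredT (fun l => lev l (mask (leq p) z))).
rewrite (big_cat_nat (leq0n (K r)) (ltnW Kp)) /= big_mkord -addrA lerD //.
apply: (@le_trans _ _ (\sum_(i < n) \sum_(K r <= l < p) lev l (mask (leq p) (x (k i))))).
  rewrite exchange_big /=; apply: ler_sum => l _.
  by rewrite mask_sum; exact: seminorm_sum.
apply: (@le_trans _ _ (\sum_(i < n) (r.+1%:R^-1 + (q (k i) <= p < q (k i).+1)%N%:R))).
  apply: ler_sum => i _; apply: tame_masked.
  exact: leq_trans rk (homo_ltW hk (leq0n i)).
rewrite big_split /= lerD //; last exact: (sum_blocks_disjoint n p hq hk).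
by rewrite sumr_const card_ord mulrC -(mulr_natr (_^-1)) mulrC.
Qed.

End Tame.

(** If no [K] worked, there would be successive windows of levels, each
    contributing more than [e] on almost all terms. Finitely many of them exceed
    the norm 1 of a late term, on which all their levels are available. *)
Lemma ultra_tail x q (U : set_system nat) : blocks x q ->
  UltraFilter U -> \oo `<=` U -> forall e : R, 0 < e ->
  exists K, forall p, U [set j | \sum_(K <= l < p) lev l (x j) <= e].
Proof.
move=> bx UU ooU e e0; have [hq x1 x0] := bx.
apply: contrapT => /forallNP h.
have /choice[P hP] : forall K, exists p,
    U [set j | e < \sum_(K <= l < p) lev l (x j)].
  move=> K; have /existsNP[p hp] := h K; exists p.
  have [//|] := in_ultra_setVsetC [set j | \sum_(K <= l < p) lev l (x j) <= e] UU.
  by apply: filterS => j /negP; rewrite -ltNge.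
pose Ks s := iter s P 0%N.
have Ks_mono s : (Ks s <= Ks s.+1)%N.
  have [j] := filter_ex (hP (Ks s)); rewrite /= -/(Ks s.+1).
  by have [//|/ltnW le] := leqP (Ks s) (Ks s.+1); rewrite big_geq // ltNge (ltW e0).
have big s : U [set j | e *+ s <= \sum_(0 <= l < Ks s) lev l (x j)].
  elim: s => [|s IH].
    by apply: (filterS _ filterT) => j _ /=; rewrite mulr0n big_nil.
  apply: filterS2 IH (hP (Ks s)) => j /= h1 h2.
  rewrite (big_cat_nat (leq0n (Ks s)) (Ks_mono s)) /= mulrSr lerD //.
  exact: ltW.
have [s hs] : exists s : nat, 1 < e *+ s.
  exists (Num.truncn e^-1).+1; rewrite -mulr_natr mulrC -ltr_pdivrMr // mul1r.
  by rewrite truncnS_gt.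
have late : U [set j | (Ks s <= j)%N] by apply: ooU; exists (Ks s).
have [j [/= h1 h2]] := filter_ex (filterI (big s) late).
have : \sum_(0 <= l < Ks s) lev l (x j) <= 1.
  rewrite big_mkord; apply: (lev_le_norm bx).
  exact: leq_trans h2 (homo_leq_geq hq j).
by lra.
Qed.

(** The ultrafilter makes the tail estimates of all precisions 1 / (r + 1)
    compatible, so the terms can be chosen one after the other, the [j]-th one
    obeying the first [j] estimates up to the levels where its predecessor
    ends. *)
Lemma tame_subsequence x q : blocks x q ->
  exists (g : nat -> nat) (q' K : nat -> nat),
    [/\ {homo g : i j / (i < j)%N}, blocks (x \o g) q' & tame (x \o g) q' K].
Proof.
move=> bx; have [hq x1 x0] := bx.
have [U [UU ooU]] := @ultraFilterLemma nat \oo _.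
have /choice[K hK] : forall r, exists K, forall p,
    U [set j | \sum_(K <= l < p) lev l (x j) <= r.+1%:R^-1].
  by move=> r; apply: (ultra_tail bx UU ooU); rewrite invr_gt0.
have step : forall jm : nat * nat, exists m' : nat, (jm.2 < m')%N /\
    forall r, (r <= jm.1)%N ->
      \sum_(K r <= l < q jm.2.+1) lev l (x m') <= r.+1%:R^-1.
  move=> [j m] /=.
  have h1 : U [set m' | (m < m')%N] by apply: ooU; exists m.+1.
  have h2 : U [set m' | forall r, (r <= j)%N ->
      \sum_(K r <= l < q m.+1) lev l (x m') <= r.+1%:R^-1].
    elim: j => [|j IH].
      by apply: filterS (hK 0%N (q m.+1)) => m' /= h r; rewrite leqn0 => /eqP ->.
    apply: filterS2 IH (hK j.+1 (q m.+1)) => m' /= a b r.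
    by rewrite leq_eqVlt ltnS => /orP[/eqP ->|/a].
  by have [m' [/= a b]] := filter_ex (filterI h1 h2); exists m'.
have [nx hnx] := choice step.
pose g := fix g j := if j is j'.+1 then nx (j, g j') else 0%N.
pose q' j := if j is j'.+1 then q (g j').+1 else 0%N.
have hg : {homo g : i j / (i < j)%N}.
  apply: (homo_ltn (r := fun a b => (a < b)%N)) => [? ? ?|i]; first exact: ltn_trans.
  exact: (hnx (i.+1, g i)).1.
exists g, q', K; split => //.
  split => [|j|i j].
  - apply: (homo_ltn (r := fun a b => (a < b)%N)) => [? ? ?|[|i]]; first exact: ltn_trans.
      exact: leq_ltn_trans (hq _ _ (ltnSn (g 0%N))).
    by apply: hq; rewrite ltnS; exact: hg.
  - exact: x1.
  - move=> h; apply: x0; apply: contra h => /andP[h1 h2]; rewrite /= h2 andbT.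
    case: i h1 {h2} => // i h1; apply: leq_trans h1.
    by apply: (homo_ltW hq); exact: (hg i i.+1).
move=> r [|j] rj; first by rewrite big_geq // invr_ge0.
exact: (hnx (j.+1, g j)).2.
Qed.

End Blocks.

(** * Spreading models *)

Section Spreading.
Context (R : realType).

(** The part of the notion of spreading model that the argument uses, in the
    form of an iterated limit. It passes to subsequences of [x]. *)
Definition spreads (V W : normedModType R) (x : nat -> V) (y : nat -> W) :=
  forall n (a : nat -> R) (d : R), 0 < d -> exists M, forall k : nat -> nat,
    {homo k : i j / (i < j)%N} -> (M <= k 0)%N ->
    `| `|\sum_(i < n) a i *: x (k i)| - `|\sum_(i < n) a i *: y i| | < d.

(** The error attached to a number of terms is fixed, so it is made small by
    padding the combination with zero coefficients; rescaling brings the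
    coefficients into [-1, 1]. *)
Lemma spreading_model_spreads (V : normedModType R) (W : completeNormedModType R)
  (x : nat -> V) (y : nat -> W) : has_spreading_model x y -> spreads x y.
Proof.
move=> [_ _ [eps [_ eps0 h]]] n a d d0.
pose c : R := 1 + \sum_(i < n) `|a i|.
have c0 : 0 < c by rewrite ltr_wpDr // sumr_ge0.
have dc : 0 < d / c by rewrite divr_gt0.
have [N _ hN] : \forall m \near \oo, eps m < d / c.
  by move: eps0 => /cvgr_lt; apply.
pose m := maxn n N.
pose b (i : 'I_m.+1) := if (i < n)%N then a i / c else 0.
have b1 i : -1 <= b i <= 1.
  rewrite -ler_norml /b; case: ifP => [il|_]; last by rewrite normr0.
  rewrite normrM normfV (gtr0_norm c0) ler_pdivrMr // mul1r /c.
  rewrite (bigD1 (Ordinal il)) //= addrCA lerDl addr_ge0 // sumr_ge0 //.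
have sumb (U : normedModType R) (u : nat -> U) :
    \sum_(i < m.+1) b i *: u i = c^-1 *: \sum_(i < n) a i *: u i.
  rewrite scaler_sumr (big_ord_widen m.+1 (fun i => c^-1 *: (a i *: u i))); last first.
    by rewrite leqW // leq_maxl.
  rewrite [RHS]big_mkcond /=; apply: eq_bigr => i _; rewrite /b.
  by case: ifP; rewrite ?scale0r // scalerA mulrC.
exists m => k hk k0.
have := h m b (fun i => k i) b1 k0 (fun i j => hk i j).
rewrite (sumb _ (fun i => x (k i))) sumb !normrZ -mulrBr normrM normr_id normfV (gtr0_norm c0).
move=> lt; have := lt_trans lt (hN m (leq_maxr n N)).
by rewrite mulrC ltr_pM2r // invr_gt0.
Qed.

Lemma spreads_subseq (V W : normedModType R) (x : nat -> V) (y : nat -> W) g :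
  {homo g : i j / (i < j)%N} -> spreads x y -> spreads (x \o g) y.
Proof.
move=> hg h n a d /(h n a)[M hM]; exists M => k hk Mk.
apply: (hM (g \o k)) => [i j ij|]; first exact: hg (hk _ _ ij).
exact: leq_trans Mk (homo_leq_geq hg _).
Qed.

Lemma homo_addn M : {homo addn M : i j / (i < j)%N}.
Proof. by move=> i j; rewrite ltn_add2l. Qed.

Lemma common_shift (P Q : (nat -> nat) -> Prop) :
  (exists M, forall k, {homo k : i j / (i < j)%N} -> (M <= k 0)%N -> P k) ->
  (exists M, forall k, {homo k : i j / (i < j)%N} -> (M <= k 0)%N -> Q k) ->
  exists M, forall k, {homo k : i j / (i < j)%N} -> (M <= k 0)%N -> P k /\ Q k.
Proof.
move=> [M hM] [N hN]; exists (maxn M N) => k hk; rewrite geq_max => /andP[a b].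
by split; [exact: hM|exact: hN].
Qed.

(** Both norms are limits of norms of far out sums of the same form. *)
Lemma spreads_shift (V W : normedModType R) (x : nat -> V) (y : nat -> W) s n :
  spreads x y -> `|\sum_(i < n) y (s + i)%N| = `|\sum_(i < n) y i|.
Proof.
move=> h; apply/eqP; rewrite -subr_eq0 -normr_le0; apply/ler_addgt0Pr => e e0.
rewrite add0r; have e2 : 0 < e / 2 by rewrite divr_gt0.
have [M hM] := common_shift (h (s + n)%N (fun i => (s <= i)%N%:R) _ e2)
                           (h n (fun=> 1) _ e2).
have sumE (U : normedModType R) (u : nat -> U) :
    \sum_(i < s + n) (s <= i)%N%:R *: u i = \sum_(i < n) u (s + i)%N.
  rewrite big_split_ord /= big1 ?add0r => [|i _]; last by rewrite leqNgt ltn_ord scale0r.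
  by apply: eq_bigr => i _; rewrite leq_addr scale1r.
have [h1 _] := hM (addn M) (@homo_addn M) (leq_addr _ _).
have hk : {homo addn (M + s) : i j / (i < j)%N} by exact: homo_addn.
have [|_ h2] := hM (addn (M + s)%N) hk; first by rewrite addn0 leq_addr.
move: h1 h2; rewrite (sumE _ (fun i => x (M + i)%N)) sumE.
have -> : \sum_(i < n) 1 *: x (M + s + i)%N = \sum_(i < n) x (M + (s + i))%N.
  by apply: eq_bigr => i _; rewrite scale1r addnA.
under [X in _ -> `|_ - `|X| | < _ -> _]eq_bigr do rewrite scale1r.
set A := `|\sum_(i < n) x _|; set B := `|\sum_(i < n) y (s + i)%N|.
set C := `|\sum_(i < n) y i| => h1 h2.
rewrite [e]splitr (_ : B - C = (A - C) - (A - B)); last by ring.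
by apply: le_trans (ler_normB _ _) _; rewrite lerD // ltW.
Qed.

Section OneSpreading.
Variables (W : normedModType R) (x : nat -> space R) (q K : nat -> nat) (y : nat -> W).
Hypotheses (bx : blocks x q) (tx : tame x q K) (xy : spreads x y).

Local Notation phi n := (`|\sum_(i < n) y i|).

Let hq : {homo q : i j / (i < j)%N}. Proof. by case: bx. Qed.

Lemma phi_spreads n (d : R) : 0 < d ->
  exists M, forall k, {homo k : i j / (i < j)%N} -> (M <= k 0)%N ->
    phi n - d <= `|\sum_(i < n) x (k i)| <= phi n + d.
Proof.
move=> /(xy n (fun=> 1))[M hM]; exists M => k hk Mk.
have := hM k hk Mk.
under eq_bigr do rewrite scale1r.
under [X in `|_ - `|X| |]eq_bigr do rewrite scale1r.
by rewrite ltr_norml => /andP[h1 h2]; apply/andP; split; lra.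
Qed.

Lemma phi_le n B : (forall M, exists k, [/\ {homo k : i j / (i < j)%N},
  (M <= k 0)%N & `|\sum_(i < n) x (k i)| <= B]) -> phi n <= B.
Proof.
move=> h; apply/ler_addgt0Pr => d /(phi_spreads n)[M hM].
have [k [hk Mk kB]] := h M; have /andP[] := hM k hk Mk; lra.
Qed.

Lemma phi_ge n B : (forall M, exists k, [/\ {homo k : i j / (i < j)%N},
  (M <= k 0)%N & B <= `|\sum_(i < n) x (k i)|]) -> B <= phi n.
Proof.
move=> h; apply/ler_addgt0Pr => d /(phi_spreads n)[M hM].
have [k [hk Mk kB]] := h M; have /andP[] := hM k hk Mk; lra.
Qed.

Lemma phi_ge1 n : (0 < n)%N -> 1 <= phi n.
Proof.
move=> n0; apply: phi_ge => M; exists (addn M); split; rewrite ?leq_addr //.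
  exact: homo_addn.
by apply: (blocks_sum_ge1 bx) => //; exact: homo_addn.
Qed.

Lemma phi1 : phi 1 = 1.
Proof.
apply/eqP; rewrite eq_le phi_ge1 // andbT; apply: phi_le => M; exists (addn M).
split; rewrite ?leq_addr ?big_ord1 //; first exact: homo_addn.
by have [_ -> _] := bx.
Qed.

Lemma phi_arity l : weight R l * (arity l)%:R <= phi (arity l).
Proof.
apply: phi_ge => M; exists (addn (maxn M l.+1)); split; first exact: homo_addn.
  by rewrite addn0 leq_maxl.
apply: (blocks_sum_lower bx); first exact: homo_addn.
by apply: leq_trans (homo_leq_geq hq _); rewrite addn0 leq_maxr.
Qed.

Lemma phi_mul N m : phi (N * m) <= N%:R * phi m.
Proof.
rewrite sum_group; apply: le_trans (ler_norm_sum _ _ _) _.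
under eq_bigr do rewrite (spreads_shift _ _ xy).
by rewrite sumr_const card_ord mulr_natl.
Qed.

(** Otherwise [phi (N.+1 ^ r)] would be at most (3/4)^r [N.+1 ^ r] for all [r].
    The exponent in [arity N] is chosen so that this contradicts [phi_arity]:
    (3/4)^3 < 1/2. *)
Lemma flat_averages N : exists m, (0 < m)%N /\ 3 / 4 * N.+1%:R * phi m <= phi (N.+1 * m).
Proof.
apply: contrapT => /forallNP h.
have {}h m : (0 < m)%N -> phi (N.+1 * m) <= 3 / 4 * N.+1%:R * phi m.
  by move=> m0; apply/ltW; rewrite ltNge; apply/negP => le; exact: (h m).
have pow r : phi (N.+1 ^ r) <= (3 / 4 * N.+1%:R) ^+ r.
  elim: r => [|r IH]; first by rewrite expn0 expr0 phi1.
  rewrite expnS exprS; apply: le_trans (h _ _) _; first by rewrite expn_gt0.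
  by rewrite ler_wpM2l.
have := le_trans (phi_arity N) (pow (3 * N.+2)%N).
rewrite /arity natrX exprMn ler_pM2r ?exprn_gt0 // exprM leNgt; apply/negP/negPn.
by rewrite /weight ltrXn2r // ?nnegrE; lra.
Qed.

(** The first bound says that levels of small arity see of an average little
    more than their weights, the second one that the norm, almost 3/4, is the
    sum over the levels below [K r] up to errors. The number 32 is a
    safety margin: 3/4 exceeds 9/16 by 6/32, more than all the errors in the
    uses of the lemma together. *)
Lemma key_estimate (K0 N m r : nat) :
  (32 <= N)%N -> (forall l, (l < K0)%N -> (32 * arity l <= N)%N) -> (0 < m)%N ->
  3 / 4 * N%:R * phi m <= phi (N * m) ->
  exists M, forall k, {homo k : i j / (i < j)%N} -> (M <= k 0)%N ->
    let z := (N%:R * phi m)^-1 *: \sum_(i < N * m) x (k i) in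
    (\sum_(l < K0) lev l z <= 9 / 16) /\
    (3 / 4 - 1 / 32 <= \sum_(l < K r) lev l z + (m%:R / phi m) / r.+1%:R + 1 / 32).
Proof.
move=> N32 Narity m0 hm.
have p1 := phi_ge1 m0; have p0 : 0 < phi m by lra.
have N0 : 32 <= N%:R :> R by rewrite ler_nat.
have a0 : 0 < N%:R * phi m by rewrite mulr_gt0 //; lra.
have d0 : 0 < phi m / 32 by rewrite divr_gt0.
have [M1 h1] := phi_spreads m d0; have [M2 h2] := phi_spreads (N * m) ltr01.
exists (maxn r (maxn M1 M2)) => k hk; rewrite !geq_max => /and3P[rk Mk1 Mk2] z.
have levz l : lev l z = (N%:R * phi m)^-1 * lev l (\sum_(i < N * m) x (k i)).
  by rewrite seminormZ gtr0_norm ?invr_gt0.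
split.
  apply: (@le_trans _ _ (\sum_(l < K0) weight R l * (9 / 8))); last first.
    by rewrite -mulr_suml; have := sum_weight R K0; lra.
  apply: ler_sum => l _; rewrite levz ler_pdivrMl //.
  have B0 : 0 <= phi m + phi m / 32 by lra.
  apply: le_trans (lev_sum_groups bx l hk m0 (N := N) _ B0) _.
    move=> t tN; have hk' : {homo (fun i => k (t * m + i)%N) : i j / (i < j)%N}.
      by move=> i j ij; apply: hk; rewrite ltn_add2l.
    have /andP[_ //] := h1 _ hk' (leq_trans Mk1 (homo_ltW hk (leq0n _))).
  have c32 : 32 * (arity l)%:R <= N%:R :> R by rewrite -natrM ler_nat Narity.
  rewrite mulrCA -mulrA ler_pM2l ?weight_gt0 //.
  have -> : phi m + phi m / 32 = 33 / 32 * phi m by field.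
  rewrite mulrA [leRHS]mulrAC ler_pM2r //; lra.
have /andP[h _] := h2 k hk Mk2.
have up := tame_upper bx tx (N * m)%N hk rk.
have zz : `|z| = (N%:R * phi m)^-1 * `|\sum_(i < N * m) x (k i)|.
  by rewrite normrZ gtr0_norm ?invr_gt0.
have small : (N%:R * phi m)^-1 <= 1 / 32.
  rewrite -[_^-1]mul1r ler_pdivrMr //; nra.
have lo : 3 / 4 - 1 / 32 <= `|z|.
  rewrite zz; apply: (@le_trans _ _ ((N%:R * phi m)^-1 * (phi (N * m) - 1))); last first.
    by rewrite ler_pM2l // invr_gt0.
  rewrite mulrBr mulr1 lerB // ler_pdivlMl // mulrC mulrA //.
apply: le_trans lo _; rewrite zz.
apply: (@le_trans _ _ ((N%:R * phi m)^-1 * (\sum_(l < K r) lev l (\sum_(i < N * m) x (k i)) +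
        (N * m)%:R / r.+1%:R + 1))).
  by rewrite ler_pM2l ?invr_gt0.
rewrite mulrDr mulr1 lerD // mulrDr mulr_sumr lerD //.
  by apply: ler_sum => l _; rewrite levz.
rewrite natrM mulrA ler_pM2r ?invr_gt0 //.
rewrite ler_pdivrMl // [leRHS](_ : _ = N%:R * m%:R) //.
by field; exact: lt0r_neq0.
Qed.

Lemma large_length K0 : exists N, (32 <= N.+1)%N /\
  forall l, (l < K0)%N -> (32 * arity l <= N.+1)%N.
Proof.
exists (32 + \sum_(l < K0) 32 * arity l)%N; split; first by rewrite -addnS leq_addr.
move=> l lK; rewrite leqW // (bigD1 (Ordinal lK)) //= addnCA leq_addr //.
Qed.

Lemma not_ell1_lower (c : R) : 0 < c -> ~ (forall n, c * n%:R <= phi n).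
Proof.
move=> c0 hc.
(* under the lower bound, the coefficients of an average add up to at most 1 / c *)
pose r := Num.truncn (32 / c).
have rc : 32 / c < r.+1%:R by rewrite truncnS_gt.
have [N [N32 Narity]] := large_length (K r).
have [m [m0 hm]] := flat_averages N.
have [M hM] := key_estimate r N32 Narity m0 hm.
have [h1 h2] := hM (addn M) (@homo_addn M) (leq_addr _ _).
have p1 := phi_ge1 m0; have p0 : 0 < phi m by lra.
have : m%:R / phi m / r.+1%:R <= 1 / 32.
  rewrite ler_pdivrMr // ler_pdivrMr //.
  have := hc m; have m0' : 0 < m%:R :> R by rewrite ltr0n.
  move: rc; rewrite ltr_pdivrMr // => rc hcm.
  have h3 : r.+1%:R * (c * m%:R) <= r.+1%:R * phi m by rewrite ler_pM2l.
  have h4 : 32 * m%:R <= r.+1%:R * c * m%:R by rewrite ler_pM2r // ltW.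
  move: h3 h4; rewrite -mulrA => h3 h4; have := le_trans h4 h3.
  by rewrite -[1 / 32 * _ * _]mulrA; set t := _ * phi m; lra.
by move: h1 h2; set S := \sum_(_ < _) _; set t := _ / r.+1%:R; lra.
Qed.

(** Taking [r] large compared with [m] makes the error from the levels beyond
    [K r] small, so the window may end there. It is essential that the window
    does not depend on where in the sequence the block is realized. *)
Lemma flat_block K0 : exists (n : nat) (a : R) (K1 M : nat),
  [/\ 0 <= a, a * phi n <= 1, (K0 <= K1)%N &
    forall k, {homo k : i j / (i < j)%N} -> (M <= k 0)%N ->
      1 / 16 <= \sum_(K0 <= l < K1) lev l (a *: \sum_(i < n) x (k i))].
Proof.
have [N [N32 Narity]] := large_length K0.
have [m [m0 hm]] := flat_averages N.
(* the coefficients of the average add up to m / phi m <= m *)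
pose r := (32 * m)%N.
have [M hM] := key_estimate r N32 Narity m0 hm.
have p1 := phi_ge1 m0; have p0 : 0 < phi m by lra.
have N0 : 0 < N.+1%:R * phi m by rewrite mulr_gt0.
exists (N.+1 * m)%N, (N.+1%:R * phi m)^-1, (maxn K0 (K r)), M; split.
- by rewrite invr_ge0 ltW.
- by rewrite ler_pdivrMl // mulr1 phi_mul.
- exact: leq_maxl.
move=> k hk Mk; have [h1 h2] := hM k hk Mk.
set z := (_ *: _) in h1 h2 *.
have h3 : m%:R / phi m / r.+1%:R <= 1 / 32.
  rewrite ler_pdivrMr // ler_pdivrMr // /r.
  have -> : (32 * m).+1%:R = 32 * m%:R + 1 :> R by rewrite -natr1 natrM.
  have m0' : 0 < m%:R :> R by rewrite ltr0n.
  have : (32 * m%:R + 1) * 1 <= (32 * m%:R + 1) * phi m.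
    by rewrite ler_pM2l //; lra.
  lra.
have h4 : \sum_(l < K r) lev l z <= \sum_(0 <= l < maxn K0 (K r)) lev l z.
  rewrite -(big_mkord xpredT (fun l => lev l z)).
  by apply: sum_nat_widen_ge0 => // [l|]; [exact: seminorm_ge0|exact: leq_maxr].
move: h1 h2 h3 h4.
rewrite (big_cat_nat (leq0n K0) (leq_maxl _ _)) /= big_mkord.
set S := \sum_(l < K0) _; set S' := \sum_(l < K r) _; set D := \sum_(_ <= _ < _) _.
by set t := _ / r.+1%:R; lra.
Qed.

End OneSpreading.
End Spreading.

(** * Embedding l_1 *)

Section Ell1.
Context (R : realType).

Lemma ell1_norm_ge (v : ell1 R) n : \sum_(i < n) `|v i| <= `|v|.
Proof.
rewrite -(big_mkord xpredT (fun i => `|v i|)).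
apply: (nondecreasing_cvgn_le _ (@ell1_cvg _ v)).
exact: nondecreasing_series.
Qed.

Lemma ell1_coord_sum n (a : nat -> R) j :
  (\sum_(i < n) a i *: ell1_unit R i) j = (j < n)%N%:R * a j.
Proof.
have -> : (\sum_(i < n) a i *: ell1_unit R i) j = \sum_(i < n) a i * (j == i)%:R.
  elim/big_rec2 : _ => // i x z _ <-; reflexivity.
have [jn|nj] := ltnP j n; last first.
  by rewrite mul0r big1 // => i _; rewrite gtn_eqF ?mulr0 // (leq_trans _ nj).
rewrite (bigD1 (Ordinal jn)) //= eqxx mulr1 big1 ?addr0 ?mul1r // => i.
by rewrite -val_eqE /= eq_sym => /negPf ->; rewrite mulr0.
Qed.

Lemma ell1_sum_units n : n%:R <= `|\sum_(i < n) 1 *: ell1_unit R i|.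
Proof.
apply: le_trans (ell1_norm_ge _ n).
have {1}-> : n%:R = \sum_(i < n) 1 :> R by rewrite sumr_const card_ord.
apply: ler_sum => i _.
by rewrite (ell1_coord_sum n (fun=> 1)) ltn_ord mulr1 normr1.
Qed.

Section Synthesis.
Variables (Y : completeNormedModType R) (y u : nat -> Y).
Hypothesis u1 : forall j, `|u j| <= 1.

Let S (v : ell1 R) := series (fun j => v j *: u j).

Lemma synthesis_cvg v : cvgn (S v).
Proof.
apply: normed_cvg; apply: series_le_cvg (@ell1_cvg _ v) => j //=.
by rewrite normrZ ler_piMr.
Qed.

Definition synthesis (v : ell1 R) : Y := limn (S v).

Lemma synthesis_linear : linear synthesis.
Proof.
move=> a v w; apply: cvg_lim => //.
have -> : S (a *: v + w) = (a *: S v) + S w.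
  apply/funext => n; rewrite /S /series /= [RHS](_ : _ = a *: (\sum_(0 <= j < n) v j *: u j) + \sum_(0 <= j < n) w j *: u j) //.
  rewrite scaler_sumr -big_split /=; apply: eq_bigr => j _.
  by rewrite scalerDl scalerA.
apply: cvgD; last exact: synthesis_cvg.
by apply: cvgZr; exact: synthesis_cvg.
Qed.

Lemma synthesis_embeds (c : R) : 0 < c ->
  (forall n (b : nat -> R), lin_span y (\sum_(j < n) b j *: u j)) ->
  (forall n (b : nat -> R), c * \sum_(j < n) `|b j| <= `|\sum_(j < n) b j *: u j|) ->
  embeds_in (ell1 R) (closed_span y).
Proof.
move=> c0 sp lo.
pose f : {linear ell1 R -> Y} :=
  HB.pack synthesis (GRing.isLinear.Build R (ell1 R) Y _ synthesis synthesis_linear).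
have cv v : S v @ \oo --> f v by exact: synthesis_cvg.
exists f; split.
  move=> v; apply: (@closed_cvg _ _ \oo _ (S v) (closed_span y) _ _ _ (cv v)).
    exact: closed_closure.
  apply: nearW => n; apply: subset_closure; rewrite /S /series /= big_mkord; exact: sp.
exists c, 1; split=> // v; rewrite mul1r.
have cn : (fun n => `|S v n|) @ \oo --> `|f v| by apply: cvg_norm; exact: cv.
have ce : series (fun i => `|v i|) @ \oo --> `|v| by exact: (@ell1_cvg _ v).
apply/andP; split.
  have cce : (fun n => c * series (fun i => `|v i|) n) @ \oo --> c * `|v|.
    by apply: cvgMr; exact: ce.
  apply: (ler_cvg_to cce cn); apply: nearW => n.
  by rewrite /S /series /= !big_mkord; exact: lo.
apply: (ler_cvg_to cn ce); apply: nearW => n.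
rewrite /S /series /=; apply: le_trans (ler_norm_sum _ _ _) _.
by apply: ler_sum => j _; rewrite normrZ ler_piMr.
Qed.

End Synthesis.
End Ell1.

Section GlidingHump.
Context (R : realType).
Variables (W : completeNormedModType R) (x : nat -> space R) (q K : nat -> nat) (y : nat -> W).
Hypotheses (bx : blocks x q) (tx : tame x q K) (xy : spreads x y).

Let hq : {homo q : i j / (i < j)%N}. Proof. by case: bx. Qed.

Lemma sum_consecutive (V : zmodType) (s : nat -> nat) (F : nat -> V) J :
  s 0%N = 0%N -> (forall j, (s j <= s j.+1)%N) ->
  \sum_(0 <= i < s J) F i = \sum_(j < J) \sum_(s j <= i < s j.+1) F i.
Proof.
move=> s0 sm; elim: J => [|J IH]; first by rewrite s0 big_ord0 big_nil.
by rewrite big_ord_recr /= -IH (big_cat_nat (leq0n _) (sm J)).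
Qed.

(** Gliding hump over the levels: the [j]-th block carries norm 1/16 on the
    levels in [Ks j, Ks j.+1), and these windows are disjoint. The lower bound is
    proved for a realization in the block sequence starting beyond level [Ks J],
    where all levels involved are available, and passes to the limit. *)
Lemma spreading_embeds_ell1 : embeds_in (ell1 R) (closed_span y).
Proof.
have /choice[nx hnx] : forall K0, exists d : nat * R * nat * nat,
    let: (n, a, K1, M) := d in
  [/\ 0 <= a, a * `|\sum_(i < n) y i| <= 1, (K0 <= K1)%N &
    forall k, {homo k : i j / (i < j)%N} -> (M <= k 0)%N ->
      1 / 16 <= \sum_(K0 <= l < K1) lev l (a *: \sum_(i < n) x (k i))].
  by move=> K0; have [n [a [K1 [M h]]]] := flat_block bx tx xy K0; exists (n, a, K1, M).
pose Ks j := iter j (fun K0 => (nx K0).1.2) 0%N.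
pose len j := (nx (Ks j)).1.1.1.
pose al j : R := (nx (Ks j)).1.1.2.
pose Ms j := (nx (Ks j)).2.
have h j : [/\ 0 <= al j, al j * `|\sum_(i < len j) y i| <= 1, (Ks j <= Ks j.+1)%N &
    forall k, {homo k : i j / (i < j)%N} -> (Ms j <= k 0)%N ->
      1 / 16 <= \sum_(Ks j <= l < Ks j.+1) lev l (al j *: \sum_(i < len j) x (k i))].
  by rewrite /al /len /Ms [Ks j.+1]/=; move: (hnx (Ks j)); case: (nx (Ks j)) => [[[]]].
have Ks0 : Ks 0%N = 0%N by [].
clearbody al len Ms Ks; clear nx hnx.
pose s j := (\sum_(i < j) len i)%N.
have s0 : s 0%N = 0%N by rewrite /s big_ord0.
have sS j : s j.+1 = (s j + len j)%N by rewrite /s big_ord_recr.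
have sm j : (s j <= s j.+1)%N by rewrite sS leq_addr.
have smono : {homo s : i j / (i <= j)%N}.
  by apply: homo_leq => //; exact: leq_trans.
clearbody s.
have block (V : zmodType) (F : nat -> V) j :
    \sum_(s j <= i < s j.+1) F i = \sum_(i < len j) F (s j + i)%N.
  rewrite -{1}[s j]add0n big_addn sS addKn big_mkord.
  by apply: eq_bigr => i _; rewrite addnC.
pose u j := al j *: \sum_(s j <= i < s j.+1) y i.
have u1 j : `|u j| <= 1.
  have [a0 a1 _ _] := h j.
  by rewrite /u normrZ ger0_norm // block (spreads_shift _ _ xy).
(* the coefficients on y of the combination of the first J blocks u j *)
pose co (b : nat -> R) J i := \sum_(j < J) (s j <= i < s j.+1)%N%:R * (b j * al j).
have coE (V : lmodType R) (w : nat -> V) b J :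
    \sum_(i < s J) co b J i *: w i =
    \sum_(j < J) b j *: (al j *: \sum_(s j <= i < s j.+1) w i).
  under eq_bigr do rewrite /co scaler_suml.
  rewrite exchange_big /=; apply: eq_bigr => j _.
  rewrite scalerA scaler_sumr.
  rewrite -(big_mkord xpredT (fun i => ((s j <= i < s j.+1)%N%:R * (b j * al j)) *: w i)).
  rewrite (big_cat_nat (leq0n (s j)) (smono _ _ (ltnW (ltn_ord j)))) /=.
  rewrite big1_seq ?add0r; last first.
    move=> i /andP[_]; rewrite mem_index_iota /= => ij.
    by rewrite leqNgt ij mul0r scale0r.
  rewrite (big_cat_nat (sm j) (smono _ _ (ltn_ord j))) /=.
  rewrite [X in _ + X]big1_seq ?addr0; last first.
    move=> i /andP[_]; rewrite mem_index_iota /= => /andP[ij _].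
    by rewrite [(i < _)%N]ltnNge ij andbF mul0r scale0r.
  by rewrite !big_nat; apply: eq_bigr => i ->; rewrite mul1r.
apply: (synthesis_embeds u1 (c := 1 / 16)) => // [J b|J b].
  by exists (s J), (co b J); rewrite coE.
apply/ler_addgt0Pr => d d0.
have [M hM] := xy (s J) (co b J) d0.
pose M' := (M + Ks J + \sum_(j < J) Ms j)%N.
have := hM (addn M') (@homo_addn M').
rewrite addn0 /M' -addnA leq_addr addnA => /(_ isT).
rewrite (coE _ (fun i => x (M' + i)%N)) coE -/u.
set z := \sum_(j < J) _ => hz.
suff lo : 1 / 16 * \sum_(j < J) `|b j| <= `|z|.
  move: hz; rewrite ltr_norml => /andP[_ hz]; apply: le_trans lo _.
  by rewrite -lerBlDl ltW.
have Kmono : {homo Ks : i j / (i <= j)%N}.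
  apply: homo_leq => // [? ? ?|j]; first exact: leq_trans.
  by have [] := h j.
pose zz j := al j *: \sum_(s j <= i < s j.+1) x (M' + i)%N.
have Qmono : {homo (fun j => q (M' + s j)%N) : i j / (i <= j)%N}.
  by move=> i j /smono ij; apply: (homo_ltW hq); rewrite leq_add2l.
have zz0 j t : ~~ (q (M' + s j) <= t < q (M' + s j.+1))%N -> (b j *: zz j) t = 0.
  move=> ht; rewrite coordZ coordZ coord_sum big1_seq ?mulr0 // => i /andP[_].
  rewrite mem_index_iota => /andP[si is_]; have [_ _ x0] := bx; apply: x0.
  apply: contra ht => /andP[h1 h2]; apply/andP; split.
    by apply: leq_trans h1; apply: (homo_ltW hq); rewrite leq_add2l.
  by apply: leq_trans h2 _; apply: (homo_ltW hq); rewrite -addnS leq_add2l.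
have zz_le j i : (j < J)%N -> `|(b j *: zz j) i| <= `|z i|.
  exact: (disjoint_sum_coord _ Qmono zz0).
apply: (@le_trans _ _ (\sum_(l < Ks J) lev l z)); last first.
  apply: sum_lev_le => i iK; rewrite coord_sum big1 // => j _; apply: zz0.
  rewrite negb_and -ltnNge (leq_trans iK) //.
  apply: leq_trans (homo_leq_geq hq _); rewrite /M'; lia.
rewrite -(big_mkord xpredT (fun l => lev l z)) (sum_consecutive _ _ Ks0); last by move=> j; have [] := h j.
rewrite mulr_sumr; apply: ler_sum => j _.
apply: (@le_trans _ _ (\sum_(Ks j <= l < Ks j.+1) lev l (b j *: zz j))).
  under eq_bigr do rewrite seminormZ.
  rewrite -mulr_sumr mulrC ler_wpM2l //.
  have [_ _ _ lo] := h j; rewrite /zz block.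
  apply: (lo (fun i => M' + (s j + i))%N) => [i i' ii'|]; first by rewrite !ltn_add2l.
  by rewrite /M' (bigD1 j) //=; lia.
by apply: ler_sum => l _; apply: seminorm_mono => i; exact: zz_le.
Qed.

End GlidingHump.

Theorem theorem2p2 (R : realType) :
  exists (X : completeNormedModType R) (e : nat -> X),
    [/\ schauder_basis e /\ normalized e /\ one_unconditional e,
        forall (x : nat -> X) (Y : completeNormedModType R) (y : nat -> Y),
          block_basis e x -> normalized x -> has_spreading_model x y ->
          ~ equivalent_seq y (@ell1_unit R)
      & forall (x : nat -> X) (Y : completeNormedModType R) (y : nat -> Y),
          block_basis e x -> normalized x -> has_spreading_model x y ->
          embeds_in (ell1 R) (closed_span y)].
Proof.
exists (space R), (@evec R); split.
- split; first exact: evec_basis.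
  split; [exact: evec_normalized|exact: evec_unconditional].
- move=> x Y y xblock x1 xy [c [C [c0 cC]]].
  have [p bx] := block_basis_blocks xblock x1.
  have [g [q [K [hg bxg txg]]]] := tame_subsequence bx.
  have sxy := spreads_subseq hg (spreading_model_spreads xy).
  apply: (not_ell1_lower bxg txg sxy c0) => n.
  have /andP[+ _] := cC n (fun=> 1).
  under [in X in _ <= X]eq_bigr do rewrite scale1r.
  apply: le_trans; rewrite ler_pM2l //; exact: ell1_sum_units.
- move=> x Y y xblock x1 xy.
  have [p bx] := block_basis_blocks xblock x1.
  have [g [q [K [hg bxg txg]]]] := tame_subsequence bx.
  apply: (spreading_embeds_ell1 bxg txg).
  exact: spreads_subseq hg (spreading_model_spreads xy).
Qed.
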